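(* Suppose the real random variable $\xi$ has a strictly positive log-concave density $\phi$ with respect to Lebesgue measure on $\mathbb{R}$. Then for any $\delta\ge0$ and any bounded non-decreasing function $g:\mathbb{R}\to\mathbb{R}$, $$\mathbb{E}[g(\xi+\delta)\mid\xi+\delta>0]=\frac{\mathbb{E}[g(\xi+\delta)1_{\{\xi+\delta>0\}}]}{\mathbb{P}(\xi+\delta>0)}\ \ge\ \frac{\mathbb{E}[g(\xi)1_{\{\xi>0\}}]}{\mathbb{P}(\xi>0)}=\mathbb{E}[g(\xi)\mid\xi>0].$$ *)

(* Defs.v *)
From HB Require Import structures.
From mathcomp Require Import all_boot all_order all_algebra.
From mathcomp Require Import all_classical all_reals all_analysis.

Set Implicit Arguments.
Unset Strict Implicit.
Unset Printing Implicit Defensive.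

Import Order.TTheory GRing.Theory Num.Theory.
Import numFieldNormedType.Exports.

Local Open Scope classical_set_scope.
Local Open Scope ring_scope.

Definition is_density (d : measure_display) (T : measurableType d)
    (R : realType) (P : probability T R) (X : {RV P >-> R}) (phi : R -> R) :=
  [/\ measurable_fun [set: R] phi,
      forall x, 0 <= phi x &
      forall A, measurable A ->
        distribution P X A = (\int[lebesgue_measure]_(x in A) (phi x)%:E)%E].

(* The logarithm [ln] is total, with junk value 0 on nonpositive reals, so this
   is meaningful only for [phi] strictly positive. *)
Definition log_concave (R : realType) (phi : R -> R) :=
  convex_function [set: R] (fun x => - ln (phi x)).

Definition cond_prob (d : measure_display) (T : measurableType d)
    (R : realType) (P : probability T R) (A : set T) : set T -> \bar R :=
  fun B => (P (B `&` A) / P A)%E.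

Definition cond_expectation (d : measure_display) (T : measurableType d)
    (R : realType) (P : probability T R) (X : T -> R) (A : set T) : \bar R :=
  (\int[cond_prob P A]_w (X w)%:E)%E.

Notation "''E_' P [ X | A ]" := (cond_expectation P X A)
  (at level 5, P, X at level 4, format "''E_' P [ X  |  A ]") : ereal_scope.

(* Main.v *)
(** Log-concavity makes [phi (y - delta) / phi y] non-decreasing in [y]: the
    law of [xi + delta] dominates that of [xi] in the likelihood-ratio order,
    which is preserved by conditioning on a half-line and implies stochastic
    order. Instead of symmetrizing a double integral, let [c] be the mean of
    [g] under the smaller conditional law, with density proportional to [p],
    and let [q] be the larger density: [g - c] and [q / p] are both
    non-decreasing, so [(g - c) (q - k p) >= 0] everywhere if [k] is the value
    of [q / p] where [g - c] changes sign, and integrating gives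
    [\int (g - c) q >= k \int (g - c) p = 0]. *)

Require Import Defs.
From HB Require Import structures.
From mathcomp Require Import all_boot all_order all_algebra.
From mathcomp Require Import all_classical all_reals all_analysis.
From mathcomp Require Import measurable_realfun ring lra.

Set Implicit Arguments.
Unset Strict Implicit.
Unset Printing Implicit Defensive.

Import Order.TTheory GRing.Theory Num.Theory.
Import numFieldNormedType.Exports.

Local Open Scope classical_set_scope.
Local Open Scope ring_scope.

(** * Bounded functions and the exchange inequality from log-concavity *)

Lemma bounded_fun_comp (R : realType) (S T : Type) (g : S -> R) (f : T -> S)
    (D : set T) :
  [bounded g y | y in [set: S]] -> [bounded g (f x) | x in D].
Proof. by move=> [M [Mr gM]]; exists M; split => // N MN x _; exact: gM. Qed.

Lemma bounded_mul_indic (R : realType) (T : Type) (X : T -> R) (A : set T) :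
  [bounded X x | x in [set: T]] ->
  [bounded (X \* \1_A) x | x in [set: T]].
Proof.
move=> [M [Mr XM]]; exists M; split => // N MN x _ /=.
by rewrite normrM indicE; case: (x \in A); rewrite ?normr1 ?mulr1 ?normr0 ?mulr0;
  [exact: XM|rewrite (le_trans _ (XM N MN x I))].
Qed.

(** The points [y - delta] and [x] are convex combinations of [x - delta] and [y] with weights [t],
    [1 - t] swapped; adding the two convexity inequalities for [- ln phi] makes the weights
    cancel. *)
Lemma log_concave_swap (R : realType) (phi : R -> R) (delta x y : R) :
  (forall x, 0 < phi x) -> log_concave phi -> 0 <= delta -> x <= y ->
  phi y * phi (x - delta) <= phi (y - delta) * phi x.
Proof.
move=> phi0 phiC d0 xy.
(* For [delta = 0] and [x = y] the denominator of [t] would vanish. *)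
have [->|dn0] := eqVneq delta 0; first by rewrite !subr0.
have s0 : 0 < y - x + delta by rewrite ltr_wpDl ?subr_ge0// lt_neqAle eq_sym dn0.
pose t := delta / (y - x + delta).
have t01 : 0 <= t <= 1.
  by rewrite divr_ge0 ?(ltW s0)//= ler_pdivrMr// mul1r lerDr subr_ge0.
have tE : t * (y - x + delta) = delta by rewrite mulfVK ?gt_eqF.
pose p : {i01 R} := Itv01 (andP t01).1 (andP t01).2.
have C (a b : R) := phiC p a b (in_setT a) (in_setT b).
have := C y (x - delta); have := C (x - delta) y.
rewrite !convRE /conv/= /unstable.onem /GRing.scale/=.
have -> : t * (x - delta) + (1 - t) * y = y - delta by lra.
have -> : t * y + (1 - t) * (x - delta) = x by lra.
move=> h1 h2.
rewrite -ler_ln ?posrE ?mulr_gt0// !lnM ?posrE//; lra.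
Qed.

(** * Integration against a density, and translation of Lebesgue measure *)

Section density.
Local Open Scope ereal_scope.

(** Since [nu] is absolutely continuous, its Radon-Nikodym derivative exists; it has the same
    integrals as [f] over all measurable sets, hence equals [f] almost everywhere. *)
Lemma integral_density (d : measure_display) (T : measurableType d)
    (R : realType) (mu : {sigma_finite_measure set T -> \bar R})
    (nu : {finite_measure set T -> \bar R}) (f : T -> R) (D : set T)
    (h : T -> \bar R) :
  measurable_fun setT f ->
  (forall x, (0 <= f x)%R) ->
  (forall A, measurable A -> nu A = \int[mu]_(x in A) (f x)%:E) ->
  measurable D -> nu.-integrable D h ->
  \int[nu]_(x in D) h x = \int[mu]_(x in D) (h x * (f x)%:E).
Proof.
move=> mf f0 fE mD hi.
have numu : nu `<< mu.
  apply/null_content_dominatesP => A mA muA.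
  rewrite fE//; apply: null_set_integral => //.
  by apply/measurable_EFinP; exact: measurable_funTS.
rewrite -(Radon_Nikodym_change_of_variables numu mD hi).
have mh := measurable_int _ hi.
have ef : mu.-integrable setT (Radon_Nikodym (charge_of_finite_measure nu) mu).
  exact: Radon_Nikodym_integrable.
apply: ae_eq_integral => //.
- by apply: emeasurable_funM => //; apply: measurable_funTS; exact: measurable_int ef.
- apply: emeasurable_funM => //.
  by apply/measurable_EFinP; exact: measurable_funTS.
apply: ae_eqe_mul2l; apply: integral_ae_eq => //.
- exact: integrableS ef.
- by apply/measurable_EFinP; exact: measurable_funTS.
- by move=> A AD mA; rewrite -Radon_Nikodym_integral//; exact: fE.
Qed.

(* [R] carries two canonical measurable structures with convertible measurable
   sets, its own and [measurableTypeR R], and [lebesgue_measure] lives on the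
   latter; hence the type annotations here and below. *)
Definition measurable_shift (R : realType) (c : R) :
  {mfun measurableTypeR R >-> measurableTypeR R} :=
  @mfun_Sub _ _ (measurableTypeR R) (measurableTypeR R) (fun x => x + c)%R
    (mem_set (measurable_funD (@measurable_id _ _ setT) (measurable_cst c))).

(** Lebesgue measure is determined by its values on half-open intervals, whose length a translation
    preserves. *)
Lemma lebesgue_measure_shift (R : realType) (c : R) (A : set R) :
  measurable A ->
  pushforward lebesgue_measure
    (fun x : measurableTypeR R => (x + c)%R : measurableTypeR R) A =
  lebesgue_measure A.
Proof.
pose mc' := measurable_shift c.
move=> mA; apply/esym.
apply: (lebesgue_measure_unique (mu := pushforward lebesgue_measure mc')) => //=.
move=> _ [[a b]] _ <-.
rewrite /pushforward/=.
rewrite (_ : _ @^-1` _ = `](a - c)%R, (b - c)%R]%classic); last first.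
  by apply/seteqP; split=> x /=; rewrite !in_itv/= ltrBlDr lerBrDr.
rewrite !lebesgue_measure_itv/= !lte_fin ltrD2r; case: ifP => // _.
by congr (_%:E); lra.
Qed.

Lemma ge0_integral_shift (R : realType) (f : R -> R) (c : R) (A : set R) :
  measurable_fun setT f -> (forall x, (0 <= f x)%R) -> measurable A ->
  \int[lebesgue_measure]_(x in [set x | A (x + c)%R]) (f x)%:E =
  \int[lebesgue_measure]_(x in A) (f (x - c)%R)%:E.
Proof.
move=> mf f0 mA.
pose mc' := measurable_shift c.
have mfc : @measurable_fun _ _ (measurableTypeR R) R setT (fun x => f (x - c))%R.
  exact: measurableT_comp mf (measurable_funPT (measurable_shift (- c))).
transitivity (\int[pushforward lebesgue_measure mc']_(x in A) (f (x - c)%R)%:E).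
  rewrite ge0_integral_pushforward//; last 2 first.
  - by apply/measurable_EFinP; apply: measurable_funTS.
  - by move=> y _; rewrite lee_fin.
  by apply: eq_integral => x _; rewrite /= addrK.
by apply: eq_measure_integral => //= B mB _; exact: lebesgue_measure_shift.
Qed.

End density.

(** * Comparison of weighted means under a monotone likelihood ratio *)

Lemma integrableMbounded (d : measure_display) (T : measurableType d)
    (R : realType) (mu : {measure set T -> \bar R}) (D : set T)
    (g p : T -> R) :
  measurable D -> measurable_fun D g -> [bounded g x | x in D] ->
  mu.-integrable D (EFin \o p) ->
  mu.-integrable D (EFin \o (fun x => g x * p x)).
Proof.
move=> mD mg [M [_ gM]] ip.
have mp : measurable_fun D p by apply/measurable_EFinP; exact: measurable_int ip.
(* Boundedness provides a bound by every number above [M], which may be negative; [|M| + 1] is such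
   a number and is nonnegative. *)
apply: (@le_integrable _ _ _ mu D mD _ (fun x => (`|M| + 1)%:E * (p x)%:E)%E).
- by apply/measurable_EFinP; exact: measurable_funM.
- move=> x Dx /=; rewrite lee_fin !normrM ler_wpM2r//.
  rewrite [leRHS]ger0_norm ?addr_ge0//; apply: (gM) => //.
  by rewrite ltr_pwDr// ler_norm.
- exact: integrableZl.
Qed.

(* Assuming monotonicity of [q / p] only along [g] avoids an order on [T]. *)
Lemma Rintegral_likelihood_ratio (d : measure_display) (T : measurableType d)
    (R : realType) (mu : {measure set T -> \bar R}) (D : set T)
    (g p q : T -> R) :
  measurable D ->
  measurable_fun D g -> [bounded g x | x in D] ->
  (forall x, D x -> 0 < p x) -> (forall x, D x -> 0 <= q x) ->
  (forall x y, D x -> D y -> g x < g y -> p y * q x <= q y * p x) ->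
  mu.-integrable D (EFin \o p) -> mu.-integrable D (EFin \o q) ->
  0 < \int[mu]_(x in D) p x ->
  (\int[mu]_(x in D) (g x * p x)) / (\int[mu]_(x in D) p x)
     * \int[mu]_(x in D) q x <= \int[mu]_(x in D) (g x * q x).
Proof.
move=> mD mg bg p0 q0 pq ip iq Ip0.
set c := _ / _.
have igp := integrableMbounded mD mg bg ip.
have igq := integrableMbounded mD mg bg iq.
have cE : \int[mu]_(x in D) (g x * p x) = c * \int[mu]_(x in D) p x.
  by rewrite /c divfK// gt_eqF.
have icp : mu.-integrable D (EFin \o (fun x => c * p x)).
  exact: (integrableZl mD c ip).
have icq : mu.-integrable D (EFin \o (fun x => c * q x)).
  exact: (integrableZl mD c iq).
pose F x := g x * p x - c * p x.
have iF : mu.-integrable D (EFin \o F).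
  exact: (integrableB mD igp icp).
pose G x := g x * q x - c * q x.
have iG : mu.-integrable D (EFin \o G).
  exact: (integrableB mD igq icq).
have F0 : \int[mu]_(x in D) F x = 0.
  by rewrite RintegralB// cE RintegralZl// subrr.
(* Otherwise [(g - c) p] is nonpositive with integral [0], so [p = 0] a.e. *)
have [z Dz cz] : exists2 z, D z & c <= g z.
  apply: contrapT => /forall2NP gc.
  have gltc x : D x -> g x < c.
    by move=> Dx; have [//|/negP] := gc x; rewrite -ltNge.
  have : \int[mu]_(x in D) p x = 0.
    rewrite /Rintegral; suff -> : (\int[mu]_(x in D) (p x)%:E = 0)%E by [].
    have mp := measurable_int _ ip.
    have /(ae_eq_integral_abs mu mD (measurable_int _ iF)) ae0 :
        (\int[mu]_(x in D) `|(F x)%:E| = 0)%E.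
      transitivity (\int[mu]_(x in D) (- (F x)%:E))%E.
        apply: eq_integral => x /set_mem Dx /=; rewrite ler0_norm//.
        by rewrite /F -mulrBl nmulr_rle0 ?subr_lt0 ?gltc// ltW// p0.
      rewrite integralN//=; last exact: integrable_add_def.
      rewrite -[X in (- X)%E]fineK ?integrable_fin_num//.
      by rewrite [X in (- X%:E)%E]F0 oppe0.
    rewrite (@ae_eq_integral _ _ _ mu D (cst 0%E)) ?integral0//.
    apply: filterS ae0 => x /= h Dx; have := h Dx => -[].
    rewrite /F -mulrBl => /eqP; rewrite mulf_eq0 subr_eq0 lt_eqF ?gltc//= => /eqP ->//.
  by move=> /eqP; rewrite gt_eqF.
(* The point [0] only serves to make [S] nonempty. *)
pose S := [set q x / p x | x in [set x | D x /\ g x < c]] `|` [set 0].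
have Sub : ubound S (q z / p z).
  move=> _ [[x [Dx gx]] <-|->]; last by rewrite divr_ge0 ?q0 ?ltW ?p0.
  rewrite ler_pdivrMr ?p0// mulrAC ler_pdivlMr ?p0// mulrC.
  exact/pq/(lt_le_trans gx).
have supS : has_sup S by split; [exists 0; right|exists (q z / p z)].
(* The ratio may jump where [g - c] changes sign; this [k] lies above all ratios with [g x < c] and
   below all those with [c <= g x]. *)
pose k := sup S.
have sgn x : D x -> 0 <= (g x - c) * (q x - k * p x).
  move=> Dx; have [gc|cg] := ltP (g x) c.
    apply: mulr_le0; rewrite subr_le0; first exact: ltW.
    rewrite -ler_pdivrMr ?p0//.
    by apply: ub_le_sup; [case: supS|left; exists x].
  rewrite mulr_ge0 ?subr_ge0// -ler_pdivlMr ?p0//.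
  apply: ge_sup; first by exists 0; right.
  move=> _ [[y [Dy gy]] <-|->]; last by rewrite divr_ge0 ?q0 ?ltW ?p0.
  rewrite ler_pdivrMr ?p0// mulrAC ler_pdivlMr ?p0// mulrC.
  exact/pq/(lt_le_trans gy).
(* The integrand is the product in [sgn], expanded. *)
have : 0 <= \int[mu]_(x in D) (G x - k * F x).
  apply: Rintegral_ge0 => x Dx; have := sgn x Dx.
  by rewrite /F /G; lra.
rewrite RintegralB//; last exact: (integrableZl mD k iF).
rewrite RintegralZl// F0 mulr0 subr0 RintegralB// RintegralZl//.
by rewrite subr_ge0.
Qed.

(** * Conditional expectation given an event, as a quotient *)

Section conditional_expectation.
Local Open Scope ereal_scope.
Context (d : measure_display) (T : measurableType d) (R : realType)
  (P : probability T R).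

(** The conditional probability has density [\1_A / P A] with respect to [P]. *)
Lemma cond_expectationE (X : T -> R) (A : set T) :
  measurable A -> P A != 0 -> measurable_fun setT X ->
  [bounded X x | x in [set: T]] ->
  'E_P[X | A] = 'E_P[(X \* \1_A)%R] / P A.
Proof.
move=> mA PA0 mX bX.
have PAfin : P A \is a fin_num by exact: fin_num_measure.
have [r r0 PAr] : exists2 r : R, (0 < r)%R & P A = r%:E.
  exists (fine (P A)); last by rewrite fineK.
  by rewrite fine_gt0// lt0e PA0 measure_ge0 -ge0_fin_numE.
have rV0 : (0 <= r^-1)%R by rewrite invr_ge0 ltW.
(* [cond_prob P A] is a bare set function; [m] is the same function carrying a measure structure. *)
pose m := mscale (NngNum rV0) (mrestr P mA).
have mE : cond_prob P A = m.
  apply/funext => B; rewrite /cond_prob PAr inver gt_eqF//=.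
  by rewrite /m /mscale/= muleC.
rewrite /cond_expectation mE.
have mf : measurable_fun setT (fun x => r^-1 * \1_A x)%R.
  by apply: measurable_funM => //; exact: measurable_indic.
rewrite (@integral_density _ _ _ P m (fun x => r^-1 * \1_A x)%R)//.
- rewrite unlock -[RHS]muleC PAr inver gt_eqF// -integralZl//.
    by apply: eq_integral => x _; rewrite -!EFinM; congr (_%:E); rewrite /=; ring.
  apply: measurable_bounded_integrable => //.
  - by rewrite -ge0_fin_numE// fin_num_measure.
  - by apply: measurable_funM => //; exact: measurable_indic.
  - by apply: bounded_mul_indic.
- by move=> x; rewrite mulr_ge0.
- move=> B mB; under eq_integral do rewrite EFinM.
  rewrite ge0_integralZl//; last by apply/measurable_EFinP; exact: measurable_indic.
  by rewrite integral_indic// setIC.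
- apply: measurable_bounded_integrable => //.
  by rewrite -ge0_fin_numE// fin_num_measure.
Qed.

End conditional_expectation.

(** * Expectations and probabilities computed from a density *)

Section random_variable_density.
Local Open Scope ereal_scope.
Context (d : measure_display) (T : measurableType d) (R : realType)
  (P : probability T R) (X : {RV P >-> R}) (phi : R -> R)
  (X_phi : is_density X phi).

Let mu := @lebesgue_measure R.

Lemma density_measurable : @measurable_fun _ _ (measurableTypeR R) R setT phi.
Proof. by case: X_phi. Qed.

Lemma density_integrable : mu.-integrable setT (EFin \o phi).
Proof.
case: (X_phi) => _ phi0 phiE.
apply/integrableP; split; first by apply/measurable_EFinP; exact: density_measurable.
under eq_integral => x _ do rewrite /= ger0_norm//.
by rewrite -phiE// probability_setT ltry.
Qed.

Lemma expectation_density (h : R -> R) : measurable_fun setT h ->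
  [bounded h x | x in [set: R]] ->
  'E_P[h \o X] = \int[mu]_x (h x * phi x)%:E.
Proof.
move=> mh bh; case: (X_phi) => mphi phi0 phiE.
have mX : @measurable_fun _ _ T (measurableTypeR R) setT X.
  exact: (measurable_funPT X).
pose X' : {mfun T >-> measurableTypeR R} :=
  @mfun_Sub _ _ T (measurableTypeR R) X (mem_set mX).
have mh' : @measurable_fun _ _ (measurableTypeR R) R setT h by [].
transitivity (\int[distribution P X']_x (h x)%:E).
  rewrite unlock integral_distribution//; first exact/measurable_EFinP.
  apply: (@measurable_bounded_integrable _ _ _ P (h \o X) setT) => //.
  - by rewrite [ltLHS]probability_setT ltry.
  - exact: measurableT_comp.
  - exact: (bounded_fun_comp X setT bh).
rewrite (@integral_density _ (measurableTypeR R) R (@lebesgue_measure R)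
  (distribution P X') phi setT)//.
apply: (@measurable_bounded_integrable _ _ _ (distribution P X') h setT) => //.
by rewrite [ltLHS]probability_setT ltry.
Qed.

End random_variable_density.

Lemma measurable_gt0 (R : realType) :
  @measurable _ (measurableTypeR R) [set x : R | 0 < x].
Proof. by rewrite -set_itvoy; exact: measurable_itv. Qed.

Section positive_part_of_density.
Local Open Scope ereal_scope.
Context (d : measure_display) (T : measurableType d) (R : realType)
  (P : probability T R) (X : {RV P >-> R}) (phi : R -> R)
  (X_phi : is_density X phi).

Let mu := @lebesgue_measure R.
Let D : set (measurableTypeR R) := [set x | (0 < x)%R].

Let mD : measurable D := @measurable_gt0 R.

Lemma probability_gt0_density :
  P [set w | (0 < X w)%R] = (\int[mu]_(x in D) phi x)%R%:E.
Proof.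
rewrite /Rintegral fineK; last first.
  exact/integrable_fin_num/(integrableS measurableT)/(density_integrable X_phi).
by case: X_phi => _ _ <-.
Qed.

Lemma expectation_gt0_density (g : R -> R) : measurable_fun setT g ->
  [bounded g x | x in [set: R]] ->
  'E_P[(fun w => g (X w) * \1_[set w | 0 < X w] w)%R] =
  (\int[mu]_(x in D) (g x * phi x))%R%:E.
Proof.
move=> mg bg.
have mgD : @measurable_fun _ _ (measurableTypeR R) R D g by exact: measurable_funTS mg.
rewrite (_ : (fun w => _) = (g \* \1_D)%R \o X); last first.
  by apply/funext => w /=; congr (_ * _)%R; rewrite !indicE.
rewrite (expectation_density X_phi)//; last 2 first.
- by apply: measurable_funM => //; exact: measurable_indic.
- exact: bounded_mul_indic.
rewrite /Rintegral fineK; last first.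
  apply/integrable_fin_num/integrableMbounded => //.
    exact: (bounded_fun_comp id D bg).
  exact/(integrableS measurableT)/(density_integrable X_phi).
rewrite [RHS]integral_mkcond; apply: eq_integral => x _.
by rewrite patchE /= indicE; case: (x \in D); rewrite ?mulr1 ?mulr0 ?mul0r.
Qed.

(** A zero integral would force [phi = 0] almost everywhere on [D], so [D] would be null, whereas
    the half-line has infinite measure. *)
Lemma Rintegral_gt0_density : (forall x, 0 < phi x)%R ->
  (0 < \int[mu]_(x in D) phi x)%R.
Proof.
move=> phi0.
have phiD : mu.-integrable D (EFin \o phi).
  exact/(integrableS measurableT)/(density_integrable X_phi).
rewrite lt0r Rintegral_ge0 ?andbT; last by move=> x _; exact: ltW.
apply/eqP => I0.
have : \int[mu]_(x in D) `|(phi x)%:E| = 0.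
  rewrite -[RHS]/(0%R%:E) -I0 /Rintegral fineK ?integrable_fin_num//.
  by apply: eq_integral => x _; rewrite /= ger0_norm// ltW.
move/(ae_eq_integral_abs mu mD (measurable_int _ phiD)) => [N [mN N0 DN]].
have : mu D = 0.
  apply: subset_measure0 N0 => // x Dx; apply: DN => /= /(_ Dx) -[].
  by apply/eqP; rewrite gt_eqF.
by rewrite /D -set_itvoy /mu lebesgue_measure_itv/= ltry.
Qed.

End positive_part_of_density.

Lemma is_density_shift (d : measure_display) (T : measurableType d) (R : realType)
  (P : probability T R) (X Y : {RV P >-> R}) (phi : R -> R) (c : R) :
  is_density X phi -> (forall w, Y w = X w + c) ->
  is_density Y (fun x => phi (x - c)).
Proof.
move=> [mphi phi0 phiE] YX; split => //.
  by apply: measurableT_comp => //; exact: measurable_funB.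
move=> A mA; rewrite -(ge0_integral_shift c mphi phi0 mA) -phiE; last first.
  exact: (measurable_funPTI (measurable_shift c) mA).
rewrite /distribution/pushforward; congr (P _).
by apply/seteqP; split => w /=; rewrite YX.
Qed.

Theorem lemma5p3 (R : realType) (d : measure_display) (T : measurableType d)
    (P : probability T R) (xi : {RV P >-> R}) (phi : R -> R)
    (phi_density : is_density xi phi)
    (phi_gt0 : forall x : R, 0 < phi x)
    (phi_log_concave : log_concave phi)
    (delta : R) (delta_ge0 : 0 <= delta)
    (g : R -> R) (g_bounded : [bounded g x | x in [set: R]])
    (g_nondecreasing : {homo g : x y / x <= y}) :
  [/\ 'E_P[(fun w => g (xi w + delta))%R | [set w | (0 < xi w + delta)%R]]
      = 'E_P[(fun w => g (xi w + delta) * \1_[set w | 0 < xi w + delta] w)%R]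
        / P [set w | (0 < xi w + delta)%R],
      'E_P[(fun w => g (xi w + delta) * \1_[set w | 0 < xi w + delta] w)%R]
        / P [set w | (0 < xi w + delta)%R]
      >= 'E_P[(fun w => g (xi w) * \1_[set w | 0 < xi w] w)%R]
         / P [set w | (0 < xi w)%R] &
      'E_P[(fun w => g (xi w) * \1_[set w | 0 < xi w] w)%R]
        / P [set w | (0 < xi w)%R]
      = 'E_P[(fun w => g (xi w))%R | [set w | (0 < xi w)%R]]]%E.
Proof.
have mg : measurable_fun setT g by exact: nondecreasing_measurable.
have mY : measurable_fun setT (fun w => xi w + delta) by exact: measurable_funD.
pose Y : {RV P >-> R} := mfun_Sub (mem_set mY).
have Y_psi : is_density Y (fun x => phi (x - delta)) by exact: is_density_shift phi_density _.
have psi_gt0 x : 0 < phi (x - delta) by [].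
have mpos (X : {RV P >-> R}) : measurable [set w | 0 < X w].
  by have := measurable_funPTI X (@measurable_gt0 R).
have bg (S : Type) (f : S -> R) (D : set S) : [bounded g (f w) | w in D].
  exact: bounded_fun_comp.
have I0 := Rintegral_gt0_density phi_density phi_gt0.
have J0 := Rintegral_gt0_density Y_psi psi_gt0.
have I0E := probability_gt0_density phi_density.
have J0E := probability_gt0_density Y_psi.
split.
- apply: (cond_expectationE (X := g \o Y)) => //.
  + exact: (mpos Y).
  + by rewrite [X in X != _]J0E eqe gt_eqF.
  + exact: measurableT_comp.
  + exact: (bg _ Y setT).
- rewrite (expectation_gt0_density phi_density mg g_bounded) I0E.
  rewrite (expectation_gt0_density Y_psi mg g_bounded) J0E.
  rewrite !inver !gt_eqF// -!EFinM lee_fin ler_pdivlMr//.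
  (* Here [p] is [phi], the density of [xi], and [q] is its translate by [delta], the density of
     [xi + delta]. *)
  apply: Rintegral_likelihood_ratio => //.
  - exact: measurable_gt0.
  - exact: measurable_funTS mg.
  - by move=> x _; exact: ltW.
  - move=> x y _ _ gxy; apply: log_concave_swap => //.
    (* Monotonicity turns [g x < g y] into [x <= y], the order in which the ratio is monotone. *)
    by rewrite leNgt; apply/negP => /ltW/g_nondecreasing; rewrite leNgt gxy.
  - apply: integrableS (density_integrable phi_density) => //.
    exact: measurable_gt0.
  - apply: integrableS (density_integrable Y_psi) => //.
    exact: measurable_gt0.
- symmetry; apply: (cond_expectationE (X := g \o xi)) => //.
  + by rewrite I0E eqe gt_eqF.
  + exact: measurableT_comp.
  + exact: (bg _ xi setT).
Qed.
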